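(* Let $n$ be the number of vertices and let $P$ be an integer with $2 \le P \le \sqrt{n}$. Let $\mathcal{P}_{\mathrm{rand}}$ be any $P$-party randomized simultaneous message protocol for maximum bipartite matching with error probability at most $\epsilon < 1/2$ in which every message has length at most $s$ bits. Then the approximation factor of $\mathcal{P}_{\mathrm{rand}}$ is $\Omega\left(\left(\frac{Pn}{s}\right)^{1/4}\right)$.
   Context: Simultaneous message (SIM) model: a bipartite graph $G=(A,B,E)$ is given, and $G_1,\dots,G_P$ are edge-disjoint subgraphs of $G$ whose union is $G$. For each $p\in[P]$, party $p$ receives only $G_p$ and sends a single message $\mu_p$ to a referee; parties cannot communicate with each other but have access to an unlimited supply of shared public random coins. Upon receiving all messages, the referee outputs a matching $N$ of $G$; protocols never output edges not present in the input graph. A randomized protocol has approximation factor $\alpha$ with error at most $\epsilon$ if, for every input, with probability at least $1-\epsilon$ the output matching $N$ satisfies $|N| \ge |M^*|/\alpha$, where $M^*$ is a maximum matching of $G$. *)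

(* Defs.v *)
From HB Require Import structures.
From mathcomp Require Import all_boot all_order all_algebra.

Set Implicit Arguments.
Unset Strict Implicit.
Unset Printing Implicit Defensive.

(* A bipartite graph (A, B, E) on the vertex set 'I_n, with B the complement
   of A; an edge is stored as the pair (a, b) with a in A and b in B. *)
Record bigraph (n : nat) := BiGraph {
  side : {set 'I_n} ;
  edges : {set 'I_n * 'I_n} ;
  edges_sub : edges \subset setX side (~: side) }.

(* The G_p are subgraphs of G on the same vertex classes. *)
Definition edge_partition (n P : nat) (G : bigraph n)
    (Gs : 'I_P -> bigraph n) : Prop :=
  [/\ forall p, side (Gs p) = side G,
      forall p q, p != q -> [disjoint edges (Gs p) & edges (Gs q)]
    & \bigcup_(p < P) edges (Gs p) = edges G].

Definition matching (n : nat) (G : bigraph n) (N : {set 'I_n * 'I_n}) : bool :=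
  (N \subset edges G) &&
  [forall e in N, forall f in N,
     (e != f) ==> [disjoint [set e.1; e.2] & [set f.1; f.2]]].

Definition max_matching (n : nat) (G : bigraph n) : nat :=
  \max_(M : {set 'I_n * 'I_n} | matching G M) #|M|.

(* The analysis libraries are loaded only after the graph definitions because
   they override finite-set notations such as [disjoint _ & _]. *)
From mathcomp Require Import all_classical all_reals all_analysis.

Import Order.TTheory GRing.Theory Num.Theory.

Local Open Scope classical_set_scope.
Local Open Scope ring_scope.

(* The public coins are a point of an arbitrary sample space Omega, seen by all
   parties and by the referee.  The vertex classes are public as well: a party
   sees them as part of its graph, the referee as its first argument.  The
   measurability fields say that messages and outputs, which take values in
   countable sets, are random variables. *)
Record sim_protocol (d : measure_display) (Omega : measurableType d)
    (n P : nat) := SimProtocol {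
  message : 'I_P -> Omega -> bigraph n -> seq bool ;
  referee : {set 'I_n} -> Omega -> {ffun 'I_P -> seq bool} ->
            {set 'I_n * 'I_n} ;
  measurable_message : forall p H m,
    measurable [set w | message p w H = m] ;
  measurable_referee : forall A ms N,
    measurable [set w | referee A w ms = N] }.

Section Protocol.
Context (d : measure_display) (Omega : measurableType d) (n P : nat).
Variable Pi : sim_protocol Omega n P.

Definition output (G : bigraph n) (Gs : 'I_P -> bigraph n) (w : Omega) :
    {set 'I_n * 'I_n} :=
  referee Pi (side G) w [ffun p => message Pi p w (Gs p)].

Definition outputs_matching : Prop :=
  forall (G : bigraph n) (Gs : 'I_P -> bigraph n), edge_partition G Gs ->
  forall w : Omega, matching G (output G Gs w).

Definition message_length_le (s : nat) : Prop :=
  forall (p : 'I_P) (w : Omega) (H : bigraph n),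
    (size (message Pi p w H) <= s)%N.

Definition approx_factor_with_error (R : realType) (Pr : probability Omega R)
    (alpha eps : R) : Prop :=
  forall (G : bigraph n) (Gs : 'I_P -> bigraph n), edge_partition G Gs ->
  ((1 - eps)%:E <=
     Pr [set w | ((max_matching G)%:R / alpha <= #|output G Gs w|%:R)%R])%E.

End Protocol.

(* Main.v *)
(** Let [b + 1] blocks be visible to each of [Q] parties: [b] of them are shared
    by all parties, one is private, and a random permutation of the blocks hides
    from a party which one is private.  In every pair of a left and a right
    block that it sees, a party holds a matching with [k + 1] edges, each of
    which encodes a random bit by its right endpoint.  The private matchings
    form a matching with [Q * (k + 1)] edges.  The referee may only output edges
    whose bits are determined by the messages.  A message of [s] bits determines
    on average at most [s + 2] bits, and by symmetry a fraction [1 / (b + 1)^2]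
    of them is in the private pair.  All other output edges touch one of the
    [3 * b * (k + 1)] shared vertices.  Hence the output has on average at most
    [3 * b * (k + 1) + Q * (s + 2) / (b + 1)^2] edges; the bound follows with
    [Q ~ P / 3], [k + 1 ~ n / (6 * Q)] and [b ~ Q / (24 * alpha)].  The
    condition [P <= sqrt n] gives [Q <= k + 1], leaving room for edge-disjoint
    matchings of all parties between the same two blocks. *)

Require Import Defs.
From HB Require Import structures.
From mathcomp Require Import all_boot all_order all_algebra all_fingroup.
From mathcomp Require Import zify lra ring.

Set Implicit Arguments.
Unset Strict Implicit.
Unset Printing Implicit Defensive.

(** * Input bits determined by a message of bounded length *)

Section KnownCoordinates.
Variables (T M : finType) (f : {ffun T -> bool} -> M).

Definition known (X : {ffun T -> bool}) : {set T} :=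
  [set t | [forall Y : {ffun T -> bool}, (f Y == f X) ==> (Y t == X t)]].

Lemma knownP X t :
  reflect (forall Y : {ffun T -> bool}, f Y = f X -> Y t = X t) (t \in known X).
Proof.
rewrite inE; apply: (iffP forallP) => [h Y fYX|h Y].
  by have /implyP := h Y; rewrite fYX => /(_ (eqxx _)) /eqP.
by apply/implyP => /eqP /h ->.
Qed.

Lemma known_fiber X Y : f X = f Y -> known X = known Y.
Proof.
move=> fXY; apply/setP => t; apply/knownP/knownP => h Z fZ.
  by rewrite (h Z) ?fXY // (h Y).
by rewrite (h Z) -?fXY // (h X).
Qed.

(** The fiber lies in a product set with one value at each known coordinate and two at every
    other. *)
Lemma card_fiber_known X :
  #|[set Y | f Y == f X]| * 2 ^ #|known X| <= 2 ^ #|T|.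
Proof.
pose F t : pred bool := if t \in known X then pred1 (X t) else predT.
have sub : #|[set Y | f Y == f X]| <=
           #|(family F : simpl_pred {ffun T -> bool})|.
  apply: subset_leq_card; apply/subsetP => Y; rewrite inE => /eqP fY.
  apply/familyP => t; rewrite /F; case: knownP => // h.
  by rewrite inE (h Y fY).
apply: leq_trans (leq_mul sub (leqnn _)) _.
rewrite card_family foldrE big_image /=.
rewrite (eq_bigr (fun t => if t \in ~: known X then 2 else 1)) => [|t _].
  by rewrite -big_mkcond prod_nat_const -expnD addnC cardsC.
by rewrite /F in_setC; case: (t \in known X); rewrite ?card1 ?card_bool.
Qed.

(* On a fiber with [m + r] known coordinates, which has density at most
   [2 ^- (m + r)], the excess [r] contributes at most [2 ^- m]. *)
Lemma sum_known m : #|M| <= 2 ^ m ->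
  \sum_X #|known X| <= m.+1 * #|{ffun T -> bool}|.
Proof.
move=> cM.
have -> : #|{ffun T -> bool}| = 2 ^ #|T| by rewrite card_ffun card_bool.
have excess : 2 ^ m * \sum_X (#|known X| - m) <= 2 ^ m * 2 ^ #|T|.
  rewrite (partition_big f predT) //= big_distrr /=.
  apply: (@leq_trans (\sum_(y : M) 2 ^ #|T|)); last first.
    by rewrite sum_nat_const leq_mul.
  apply: leq_sum => y _.
  have [X /eqP fX|none] := pickP (fun X => f X == y); last first.
    by rewrite big_pred0 ?muln0.
  rewrite (eq_bigr (fun=> #|known X| - m)); last first.
    by move=> Y /eqP fY; rewrite (@known_fiber Y X) // fY fX.
  rewrite sum_nat_cond_const.
  apply: leq_trans (card_fiber_known X).
  rewrite (_ : #|_| = #|[set Y | f Y == f X]|); last first.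
    by rewrite fX; apply: eq_card => Y; rewrite !inE.
  have [|lt] := leqP #|known X| m.
    by rewrite -subn_eq0 => /eqP ->; rewrite !muln0.
  (* With [r = #|known X| - m], what remains is [r < 2 ^ r]. *)
  rewrite mulnCA leq_mul2l; apply/orP; right.
  rewrite -{2}(subnKC (ltnW lt)) expnD leq_mul2l.
  by apply/orP; right; apply: ltnW; exact: ltn_expl.
rewrite leq_pmul2l ?expn_gt0 // in excess.
apply: (@leq_trans (\sum_(X : {ffun T -> bool}) (m + (#|known X| - m)))).
  by apply: leq_sum => X _; rewrite -maxnE leq_maxr.
rewrite big_split /= sum_nat_const card_ffun card_bool mulSn mulnC addnC.
by rewrite leq_add2r.
Qed.

End KnownCoordinates.

(** The lengths up to [s] contribute a geometric sum. Taking [m = s.+1] in [sum_known] then produces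
    the factor [s.+2]. *)
Lemma card_bseq_bool s : #|{bseq s of bool}| <= 2 ^ s.+1.
Proof.
rewrite card_bseq card_bool; apply: ltnW.
elim: s.+1 => [|m IH]; first by rewrite big_ord0.
by rewrite big_ord_recr /= expnS mul2n -addnn -addSn leq_add2r.
Qed.

(** * Averages over permutations *)

Section PermAverage.
Variables (T : finType) (D : {set T}) (c : T).
Hypothesis cD : c \in D.

(** Precomposing [u] with the transposition of [c] and a point [a] of [D] keeps [u @: D] and turns
    [u c] into [u a], so all points of [D] contribute equally. *)
Lemma sum_perm_orbit (F : {set T} -> T -> nat) :
  #|D| * \sum_(u : {perm T}) F (u @: D) (u c) =
  \sum_(u : {perm T}) \sum_(x in u @: D) F (u @: D) x.
Proof.
rewrite -sum_nat_const.
rewrite [RHS](eq_bigr (fun u : {perm T} => \sum_(a in D) F (u @: D) (u a))).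
  rewrite [RHS]exchange_big /=; apply: eq_bigr => a aD.
  rewrite (reindex_inj (mulgI (tperm a c))) /=; apply: eq_bigr => u _.
  rewrite permM tpermR; congr F.
  have tD : tperm a c @: D = D.
    apply/eqP; rewrite eqEcard (card_imset _ perm_inj) leqnn andbT.
    by apply/subsetP => _ /imsetP[x xD ->]; case: tpermP => // ->.
  by rewrite -{2}tD -imset_comp; apply: eq_imset => x; rewrite permM.
by move=> u _; rewrite big_imset //= => ? ? _ _; exact: perm_inj.
Qed.

Lemma sum_perm2_orbit (F : {set T} -> {set T} -> T -> T -> nat) :
  #|D| ^ 2 * \sum_(u : {perm T}) \sum_(v : {perm T})
     F (u @: D) (v @: D) (u c) (v c) =
  \sum_(u : {perm T}) \sum_(v : {perm T})
     \sum_(x in u @: D) \sum_(y in v @: D) F (u @: D) (v @: D) x y.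
Proof.
rewrite -mulnn -mulnA.
rewrite (sum_perm_orbit (fun A x => \sum_(v : {perm T}) F A (v @: D) x (v c))).
rewrite big_distrr /=; apply: eq_bigr => u _.
rewrite big_distrr [RHS]exchange_big; apply: eq_bigr => x _ /=.
exact: (sum_perm_orbit (fun B y => F (u @: D) B x y)).
Qed.
End PermAverage.

(** * Cardinality bounds for unions and matchings *)

Lemma leq_card_bigcup (I T : finType) (F : I -> {set T}) :
  #|\bigcup_i F i| <= \sum_i #|F i|.
Proof.
elim/big_rec2: _ => [|i m A _ le]; first by rewrite cards0.
by apply: leq_trans (leq_card_setU _ _) _; rewrite leq_add2l.
Qed.

(** With [h] the left or the right endpoint, this bounds the number of matching edges that end in a
    vertex set by the size of that set. *)
Lemma matching_injective n (G : bigraph n) N (h : 'I_n * 'I_n -> 'I_n) :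
  matching G N -> (forall e, h e \in [set e.1; e.2]) -> {in N &, injective h}.
Proof.
move=> /andP[_ /forall_inP mN] hE e f eN fN hef.
have /forall_inP/(_ f fN)/implyP := mN e eN.
have [//|ne /(_ isT) /pred0P /(_ (h e))] := eqVneq e f.
by rewrite /= hE hef hE.
Qed.

(** * The hard instances *)

Section HardInstance.
Variables (n P Q b k : nat).
Notation block := 'I_(b + Q).
Notation slot := (block * block * 'I_k.+1)%type.
Notation bits := {ffun 'I_Q * slot -> bool}.
Notation input := ({perm block} * {perm block} * bits)%type.
Hypotheses (leQP : Q <= P) (leQk : Q <= k.+1).
(** [inl] marks left vertices and [inr] right ones. A right vertex also carries a bit, so that the
    choice of endpoint encodes it. *)
Variable phi : (block * 'I_k.+1) + (block * 'I_k.+1 * bool) -> 'I_n.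
Hypothesis phi_inj : injective phi.

Definition left_side := [set phi (inl v) | v : block * 'I_k.+1].

(** Cutting [E] down to the two sides gives a graph for every [E]; by [slot_edge_sides] no edge of
    an instance is lost. *)
Definition bip (E : {set 'I_n * 'I_n}) : bigraph n :=
  BiGraph (subsetIr E (setX left_side (~: left_side))).

(** The first [b] indices of [block] are the shared blocks, the last [Q] the private ones. *)
Definition private (q : 'I_Q) : block := rshift b q.

Definition blocks (q : 'I_Q) : {set block} :=
  private q |: [set lshift Q j | j : 'I_b].

(* The shift by [q] keeps the edges of different parties distinct, even between
   blocks which they share. *)
Definition slot_edge (q : 'I_Q) (X : bits) (t : slot) : 'I_n * 'I_n :=
  (phi (inl (t.1.1, t.2)),
   phi (inr (t.1.2, (t.2 + inord q)%R, X (q, t)))).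

Definition party_edges q (SL SR : {set block}) X :=
  [set slot_edge q X t | t in setX (setX SL SR) [set: 'I_k.+1]].

(** Parties with index at least [Q] receive no edges. *)
Definition parts (F : 'I_Q -> {set 'I_n * 'I_n}) (p : 'I_P) : bigraph n :=
  bip (oapp F set0 (insub (val p))).

Definition whole (F : 'I_Q -> {set 'I_n * 'I_n}) : bigraph n :=
  bip (\bigcup_q F q).

Lemma card_blocks q : #|blocks q| = b.+1.
Proof.
rewrite cardsU1 card_imset ?card_ord; last exact: lshift_inj.
case: imsetP => // -[j _ /eqP].
by rewrite eq_sym eq_lrshift.
Qed.

(** The left endpoint reveals the unshifted index. Comparing it with the right endpoint gives [q]
    modulo [k.+1], hence [q] itself because [Q <= k.+1]. *)
Lemma slot_edge_inj q q' X X' t t' : slot_edge q X t = slot_edge q' X' t' ->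
  [/\ q = q', t = t' & X (q, t) = X' (q', t')].
Proof.
case: t t' => [[x y] i] [[x' y'] i'].
case=> /phi_inj[<- <-] /phi_inj /=[<- /eqP qq' Xt].
have eqq : q = q'.
  have lt (p : 'I_Q) : p < k.+1 by exact: leq_trans leQk.
  apply/val_inj/eqP; move: qq'.
  by rewrite eqn_modDl !inordK ?modn_small.
by split.
Qed.

Lemma inl_left v : phi (inl v) \in left_side.
Proof. exact: imset_f. Qed.

Lemma inr_left v : phi (inr v) \notin left_side.
Proof. by apply/imsetP => -[v' _ /phi_inj]. Qed.

Lemma slot_edge_sides q X t : slot_edge q X t \in setX left_side (~: left_side).
Proof. by rewrite !inE inl_left inr_left. Qed.

Lemma parts_widen F q : parts F (widen_ord leQP q) = bip (F q).
Proof. by rewrite /parts /= valK. Qed.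

(** The family is arbitrary because [out_known] also needs graphs in which one party uses other bits
    than the rest. *)
Lemma edge_partition_parts (F : 'I_Q -> {set 'I_n * 'I_n}) :
  (forall p q, p != q -> [disjoint F p & F q]) ->
  edge_partition (whole F) (parts F).
Proof.
move=> disj; split=> // [p q pq|].
  rewrite -setI_eq0 -subset0; apply/subsetP => e; rewrite !inE.
  case: insubP => [p' _ vp|]; last by rewrite inE.
  case: insubP => [q' _ vq|]; last by rewrite inE andbF.
  move=> /= /andP[/andP[ep _] /andP[eq _]].
  have /disj /pred0P /(_ e) : p' != q'.
    by apply: contraNneq pq => pq'; apply/eqP/val_inj; rewrite -vp -vq pq'.
  by rewrite /= ep eq.
apply/setP => e; apply/bigcupP/idP => [[p _]|].
  rewrite !inE => /andP[ep ->]; rewrite andbT.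
  move: ep; case: insubP => [q _ _ /= eq|]; last by rewrite inE.
  by apply/bigcupP; exists q.
rewrite inE => /andP[/bigcupP[q _ eq] sides].
by exists (widen_ord leQP q) => //; rewrite parts_widen inE eq.
Qed.

Definition instance (w : input) (q : 'I_Q) :=
  party_edges q (w.1.1 @: blocks q) (w.1.2 @: blocks q) w.2.

Lemma disjoint_party_edges SL SR (Z : 'I_Q -> bits) p q : p != q ->
  [disjoint party_edges p (SL p) (SR p) (Z p) &
            party_edges q (SL q) (SR q) (Z q)].
Proof.
move=> pq; rewrite -setI_eq0 -subset0; apply/subsetP => e.
rewrite inE => /andP[/imsetP[t _ ->] /imsetP[t' _ /slot_edge_inj[epq]]].
by rewrite epq eqxx in pq.
Qed.

Lemma instance_partition w :
  edge_partition (whole (instance w)) (parts (instance w)).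
Proof.
apply: edge_partition_parts => p q.
exact: (@disjoint_party_edges (fun q => w.1.1 @: blocks q)
          (fun q => w.1.2 @: blocks q) (fun=> w.2)).
Qed.

(** Private blocks of different parties are distinct on both sides, and inside a block the cyclic
    shift permutes the indices; so the private edges form a matching. *)
Lemma max_matching_instance w : Q * k.+1 <= max_matching (whole (instance w)).
Proof.
case: w => [[u v] X]; set w := (u, v, X).
pose E (a : 'I_Q * 'I_k.+1) :=
  slot_edge a.1 X (u (private a.1), v (private a.1), a.2).
have E1 a c : (E a).1 = (E c).1 -> a = c.
  case: a c => [q i] [q' i'] /= /phi_inj[/perm_inj /eqP + ->].
  by rewrite eq_rshift => /eqP ->.
have E2 a c : (E a).2 = (E c).2 -> a = c.
  case: a c => [q i] [q' i'] /= /phi_inj[/perm_inj /eqP].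
  rewrite eq_rshift => /eqP -> /eqP; rewrite eqn_modDr !modn_small // => /eqP.
  by move/val_inj ->.
apply: (@bigmax_sup _ (E @: setT)); last first.
  rewrite card_imset; last by move=> a c ac; apply: E1; rewrite ac.
  by rewrite cardsT card_prod !card_ord.
apply/andP; split.
  apply/subsetP => _ /imsetP[[q i] _ ->]; rewrite in_setI slot_edge_sides andbT.
  apply/bigcupP; exists q => //; apply/imsetP.
  exists (u (private q), v (private q), i) => //.
  rewrite !in_setX inE andbT.
  by apply/andP; split; apply: imset_f; apply: setU11.
apply/forall_inP => _ /imsetP[a _ ->]; apply/forall_inP => _ /imsetP[c _ ->].
apply/implyP => ne; have ac : a != c by apply: contraNneq ne => ->.
have lr a' c' : (E a').1 != (E c').2.
  by apply/eqP => h; have := inl_left (u (private a'.1), a'.2);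
     rewrite [phi _]h (negbTE (inr_left _)).
rewrite -setI_eq0 -subset0; apply/subsetP => x.
rewrite in_setI !in_set2 => /andP[/orP[]/eqP-> /orP[]/eqP h].
- by rewrite (E1 _ _ h) eqxx in ac.
- by have := lr a c; rewrite h eqxx.
- by have := lr c a; rewrite h eqxx.
- by rewrite (E2 _ _ h) eqxx in ac.
Qed.

(** * Deterministic protocols on the hard instances *)

Section DeterministicProtocol.
Variables (s : nat) (msg : 'I_P -> bigraph n -> seq bool).
Variable ref : {ffun 'I_P -> seq bool} -> {set 'I_n * 'I_n}.
Hypothesis msg_size : forall p H, size (msg p H) <= s.
Hypothesis ref_matching : forall G Gs, edge_partition G Gs ->
  side G = left_side -> matching G (ref [ffun p => msg p (Gs p)]).

Definition out w := ref [ffun p => msg p (parts (instance w) p)].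

(** Once the visible blocks are fixed, the message is a function of the bits alone with values in a
    finite type, as [sum_known] requires. *)
Definition party_message q SL SR (X : bits) : {bseq s of bool} :=
  Bseq (msg_size (widen_ord leQP q) (bip (party_edges q SL SR X))).

Definition known_private (w : input) q :=
  [set i | (q, (w.1.1 (private q), w.1.2 (private q), i)) \in
     known (party_message q (w.1.1 @: blocks q) (w.1.2 @: blocks q)) w.2].

(* If the bit of an output edge were not determined by the message, flipping it
   would leave the output unchanged but remove the edge from the graph. *)
Lemma out_known w e : e \in out w -> exists q t,
  [/\ t \in setX (setX (w.1.1 @: blocks q) (w.1.2 @: blocks q)) setT,
      e = slot_edge q w.2 t &
      (q, t) \in
        known (party_message q (w.1.1 @: blocks q) (w.1.2 @: blocks q)) w.2].
Proof.
case: w => [[u v] X] /=; set w := (u, v, X) => eN.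
have /andP[/subsetP/(_ e eN)] := ref_matching (instance_partition w) erefl.
rewrite in_setI => /andP[/bigcupP[q _ /imsetP[t tS et]] _] _.
exists q, t; split=> //; apply/knownP => Y fY.
pose Z q' := if q' == q then Y else X.
pose F' q' := party_edges q' (u @: blocks q') (v @: blocks q') (Z q').
have part' : edge_partition (whole F') (parts F').
  apply: edge_partition_parts => p' q'.
  exact: (@disjoint_party_edges (fun q => u @: blocks q)
            (fun q => v @: blocks q)).
have eN' : e \in ref [ffun p => msg p (parts F' p)].
  congr (e \in ref _): eN; apply/ffunP => p; rewrite !ffunE /parts.
  case: insubP => //= q' _ vq'; have [qq'|ne] := eqVneq q' q; last first.
    by rewrite /F' /Z (negbTE ne).
  have -> : p = widen_ord leQP q by apply: val_inj; rewrite /= -vq' qq'.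
  by move/(congr1 val): fY; rewrite /= /F' /Z qq' eqxx => <-.
have /andP[/subsetP/(_ e eN')] := ref_matching part' erefl.
rewrite in_setI => /andP[/bigcupP[q' _ /imsetP[t' _ et']] _] _.
move: et'; rewrite et => /slot_edge_inj[<- <- ->].
by rewrite /Z eqxx.
Qed.

(** Every output edge is known by [out_known]. Outside the private pair it meets one of [b * k.+1]
    shared left vertices or [2 * b * k.+1] shared right ones, and a matching uses each vertex at
    most once. *)
Lemma card_out w :
  #|out w| <= 3 * b * k.+1 + \sum_q #|known_private w q|.
Proof.
have mN : matching (whole (instance w)) (out w).
  exact: (ref_matching (instance_partition w) erefl).
pose PL := [set phi (inl (w.1.1 (lshift Q a.1), a.2)) | a : 'I_b * 'I_k.+1].
pose PR := [set phi (inr (w.1.2 (lshift Q a.1.1), a.1.2, a.2)) |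
               a : 'I_b * 'I_k.+1 * bool].
have cPL : #|PL| <= b * k.+1.
  by apply: leq_trans (leq_imset_card _ _) _; rewrite card_prod !card_ord.
have cPR : #|PR| <= b * k.+1 * 2.
  apply: leq_trans (leq_imset_card _ _) _.
  by rewrite !card_prod !card_ord card_bool.
pose NL := [set e in out w | e.1 \in PL].
pose NR := [set e in out w | e.2 \in PR].
have cNL : #|NL| <= #|PL|.
  have inj : {in NL &, injective fst}.
    move=> e f; rewrite !inE => /andP[eN _] /andP[fN _].
    by apply: (matching_injective mN) => // a; rewrite !inE eqxx.
  rewrite -(card_in_imset inj); apply: subset_leq_card.
  by apply/subsetP => _ /imsetP[e + ->]; rewrite inE => /andP[].
have cNR : #|NR| <= #|PR|.
  have inj : {in NR &, injective snd}.
    move=> e f; rewrite !inE => /andP[eN _] /andP[fN _].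
    by apply: (matching_injective mN) => // a; rewrite !inE eqxx orbT.
  rewrite -(card_in_imset inj); apply: subset_leq_card.
  by apply/subsetP => _ /imsetP[e + ->]; rewrite inE => /andP[].
pose NP := \bigcup_q
  [set slot_edge q w.2 (w.1.1 (private q), w.1.2 (private q), i)
     | i in known_private w q].
have cNP : #|NP| <= \sum_q #|known_private w q|.
  apply: leq_trans (leq_card_bigcup _) _.
  by apply: leq_sum => q _; exact: leq_imset_card.
have : out w \subset NL :|: NR :|: NP.
  apply/subsetP => e eN.
  have [q [[[x y] i] [/setXP[/setXP[/= xL yR] _] ee kn]]] := out_known eN.
  case/imsetP: xL ee kn => a aB ->; case/imsetP: yR => c cB -> ee kn.
  case/setU1P: aB ee kn => [->|/imsetP[j _ ->]]; last first.
    move=> ee _; rewrite !inE eN /=; apply/orP; left; apply/orP; left.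
    by rewrite ee; apply/imsetP; exists (j, i).
  case/setU1P: cB => [->|/imsetP[j _ ->]]; last first.
    move=> ee _; rewrite !inE eN /=; apply/orP; left; apply/orP; right.
    by rewrite ee; apply/imsetP; eexists (_, _, _).
  move=> ee kn; apply/setUP; right; apply/bigcupP; exists q => //.
  by rewrite ee; apply: imset_f; rewrite inE.
move=> /subset_leq_card /leq_trans -> //.
apply: leq_trans (leq_card_setU _ _) _; apply: leq_add cNP.
apply: leq_trans (leq_card_setU _ _) _.
have -> : 3 * b * k.+1 = b * k.+1 + b * k.+1 * 2 by lia.
exact: leq_add (leq_trans cNL cPL) (leq_trans cNR cPR).
Qed.

(** The message depends on the permutations only through the two sets of visible blocks. Given these
    sets, each of the [b.+1 ^ 2] visible pairs is equally often the private one, and [sum_known]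
    bounds the total over all pairs. *)
Lemma sum_known_private q :
  b.+1 ^ 2 * \sum_w #|known_private w q| <=
  s.+2 * #|{: input}|.
Proof.
pose kn SL SR := known (party_message q SL SR).
pose F SL SR x y := \sum_(X : bits) #|[set i | (q, (x, y, i)) \in kn SL SR X]|.
have -> : \sum_w #|known_private w q| =
    \sum_(u : {perm block}) \sum_(v : {perm block})
      F (u @: blocks q) (v @: blocks q) (u (private q)) (v (private q)).
  by rewrite pair_bigA pair_bigA; apply: eq_bigr => -[[u v] X].
rewrite -{1}(card_blocks q) sum_perm2_orbit ?setU11 //.
have bound (SL SR : {set block}) :
    \sum_(x in SL) \sum_(y in SR) F SL SR x y <= s.+2 * #|{: bits}|.
  have := sum_known (party_message q SL SR) (card_bseq_bool s).
  apply: leq_trans.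
  (* Extending the sum to all pairs of blocks only enlarges it and makes it count known coordinates
     of the form [(q, t)]. *)
  apply: (@leq_trans (\sum_x \sum_y F SL SR x y)).
    rewrite [leqLHS]big_mkcond; apply: leq_sum => x _; case: ifP => // _.
    by rewrite [leqLHS]big_mkcond; apply: leq_sum => y _; case: ifP.
  rewrite pair_bigA exchange_big; apply: leq_sum => X _ /=.
  apply: (@leq_trans #|[set t : slot | (q, t) \in kn SL SR X]|).
    rewrite -[leqRHS]sum1dep_card [leqRHS]big_mkcond.
    rewrite [leqRHS](eq_bigr (fun t : slot =>
      if (q, (t.1, t.2)) \in kn SL SR X then 1 else 0)); last by case.
    rewrite -(pair_bigA _ (fun p i =>
      if (q, (p, i)) \in kn SL SR X then 1 else 0)) /=.
    by apply: leq_sum => -[x y] _; rewrite -sum1dep_card big_mkcond.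
  rewrite -(@card_imset _ _ (pair q)) => [|t t' [->] //].
  apply: subset_leq_card; apply/subsetP => _ /imsetP[t + ->].
  by rewrite inE.
apply: leq_trans (_ : \sum_(u : {perm block}) \sum_(v : {perm block})
                        s.+2 * #|{: bits}| <= _).
  by apply: leq_sum => u _; apply: leq_sum => v _; exact: bound.
by rewrite !sum_nat_const !card_prod [leqRHS]mulnC -!mulnA (mulnC s.+2).
Qed.

Lemma sum_card_out :
  b.+1 ^ 2 * \sum_w #|out w| <=
  #|{: input}| *
    (b.+1 ^ 2 * (3 * b * k.+1) + Q * s.+2).
Proof.
have : \sum_w #|out w| <=
  \sum_(w : input) (3 * b * k.+1 + \sum_q #|known_private w q|).
  by apply: leq_sum => w _; exact: card_out.
rewrite big_split /= sum_nat_const exchange_big /= => le.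
apply: leq_trans (leq_mul (leqnn _) le) _.
rewrite mulnDr mulnCA mulnDr leq_add2l big_distrr /=.
apply: (@leq_trans (\sum_(q < Q) s.+2 * #|{: input}|)).
  by apply: leq_sum => q _; exact: sum_known_private.
by rewrite sum_nat_const card_ord; lia.
Qed.

End DeterministicProtocol.
End HardInstance.

(* Fixing the public coins by averaging *)
From mathcomp Require Import all_classical all_reals all_analysis.
From mathcomp Require Import measurable_realfun.

Import Order.TTheory GRing.Theory Num.Theory.
Local Open Scope classical_set_scope.
Local Open Scope ring_scope.

(** The expected number of events that occur is at least [#|I| * (1 - eps)], which exceeds half of
    [#|I|]. *)
Lemma exists_majority (R : realType) (d : measure_display)
    (Omega : measurableType d) (Pr : probability Omega R) (I : finType)
    (A : I -> set Omega) (eps : R) (i0 : I) :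
  eps < 1 / 2 -> (forall i, measurable (A i)) ->
  (forall i, ((1 - eps)%:E <= Pr (A i))%E) ->
  exists w, (#|I| < 2 * \sum_i (w \in A i))%N.
Proof.
move=> eps2 mA PA; apply/not_existsP => few.
have cI : (0 < #|I|)%N by apply/card_gt0P; exists i0.
have low : ((#|I|%:R * (1 - eps))%:E <= \sum_i Pr (A i))%E.
  rewrite mulr_natl -sumr_const -sumEFin.
  by apply: lee_sum => i _; exact: PA.
have up : (\sum_i Pr (A i) <= (#|I|%:R / 2)%:E)%E.
  have -> : (\sum_i Pr (A i) = \int[Pr]_w (\sum_i (\1_(A i) w)%:E))%E.
    rewrite ge0_integral_sum //.
    - by apply: eq_bigr => i _; rewrite integral_indic // setIT.
    - by move=> i; apply/measurable_EFinP; exact: measurable_indic.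
  apply: (@le_trans _ _ (\int[Pr]_w (cst (#|I|%:R / 2)%:E w))%E); last first.
    rewrite integral_cst // [X in (_ * X)%E](_ : _ = 1%E) ?mule1 //.
    exact: probability_setT.
  apply: ge0_le_integral => //.
  - by move=> w _; apply: sume_ge0.
  - apply: emeasurable_sum => i; apply/measurable_EFinP.
    exact: measurable_indic.
  - move=> w _; rewrite sumEFin lee_fin.
    have /negP := few w; rewrite -leqNgt => le.
    have -> : \sum_i \1_(A i) w = (\sum_i (w \in A i))%N%:R :> R.
      by rewrite natr_sum; apply: eq_bigr => i _; rewrite indicE.
    by rewrite ler_pdivlMr // -natrM mulnC ler_nat.
have := le_trans low up; rewrite lee_fin ler_pM2l ?ltr0n //.
by move: eps2; lra.
Qed.

(** * Randomized protocols on the hard instances *)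

Section Protocol.
Context (R : realType) (d : measure_display) (Omega : measurableType d).
Context (Pr : probability Omega R) (n P : nat).
Variable Pi : sim_protocol Omega n P.

(** Message vectors and outputs range over countable types, so splitting by their values writes the
    event as a countable union of measurable ones. *)
Lemma measurable_output (G : bigraph n) (Gs : 'I_P -> bigraph n)
    (S : pred {set 'I_n * 'I_n}) :
  measurable [set w | S (output Pi G Gs w)].
Proof.
have -> : [set w | S (output Pi G Gs w)] =
   \bigcup_(a : {ffun 'I_P -> seq bool} * {set 'I_n * 'I_n})
     ([set _ | S a.2] `&` ((\bigcap_p [set w | message Pi p w (Gs p) = a.1 p])
      `&` [set w | referee Pi (side G) w a.1 = a.2])).
  apply/seteqP; split=> [w Sw|w [[ms N] _ /= [SN [msE refE]]]].
    exists ([ffun p => message Pi p w (Gs p)], output Pi G Gs w) => //=.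
    by split=> //; split=> // p _ /=; rewrite ffunE.
  rewrite /= /output (_ : [ffun _ => _] = ms) ?refE //.
  by apply/ffunP => p; rewrite ffunE; exact: msE.
apply: countable_bigcupT_measurable => // -[ms N] /=.
apply: measurableI.
  have -> : [set _ : Omega | S N] = if S N then setT else set0.
    by case: (S N); apply/seteqP; split.
  by case: ifP.
apply: measurableI; last exact: measurable_referee.
apply: fin_bigcap_measurable => // p _; exact: measurable_message.
Qed.


Variables (alpha eps : R).
Hypotheses (eps2 : eps < 1 / 2) (alpha0 : 0 < alpha).
Hypothesis PiM : outputs_matching Pi.
Hypothesis PiA : approx_factor_with_error Pi Pr alpha eps.

(** This is the averaging half of Yao's principle: it reduces the lower bound to deterministic
    protocols. *)
Lemma exists_good_coins (I : finType) (G : I -> bigraph n)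
    (Gs : I -> 'I_P -> bigraph n) (i0 : I) :
  (forall i, edge_partition (G i) (Gs i)) ->
  exists w, (#|I| < 2 * \sum_i
    ((max_matching (G i))%:R / alpha <= #|output Pi (G i) (Gs i) w|%:R)%R)%N.
Proof.
move=> part.
pose S i : pred {set 'I_n * 'I_n} :=
  fun N => (max_matching (G i))%:R / alpha <= #|N|%:R.
have [w few] := exists_majority i0 eps2
  (fun i => measurable_output (G i) (Gs i) (S i)) (fun i => PiA (part i)).
exists w; apply: leq_trans few _; rewrite leq_mul2l /=; apply: leq_sum => i _.
by apply/eq_leq; congr nat_of_bool; apply/idP/idP; rewrite inE.
Qed.

(** Some coins succeed on this single input, where the output is no larger than a maximum
    matching. *)
Lemma approx_factor_ge1 (G : bigraph n) (Gs : 'I_P -> bigraph n) :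
  edge_partition G Gs ->
  (0 < max_matching G)%N -> 1 <= alpha.
Proof.
move=> part G0.
have [w] := @exists_good_coins unit (fun=> G) (fun=> Gs) tt (fun=> part).
rewrite big_const card_unit /= addn0.
case: leP => // le _.
have out_le : (#|output Pi G Gs w| <= max_matching G)%N.
  by apply: leq_bigmax_cond; exact: PiM.
rewrite ler_pdivrMr // in le.
have : (max_matching G)%:R <= (max_matching G)%:R * alpha.
  by apply: le_trans le _; rewrite ler_pM2r // ler_nat.
by rewrite ler_pMr // ltr0n.
Qed.

(** A block and an index use one left vertex and two right ones, hence the factor 3. *)
Lemma exists_embedding b Q k : (3 * ((b + Q) * k.+1) <= n)%N ->
  exists phi : ('I_(b + Q) * 'I_k.+1) + ('I_(b + Q) * 'I_k.+1 * bool) -> 'I_n,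
    injective phi.
Proof.
move=> le.
have le' : (#|{: ('I_(b + Q) * 'I_k.+1) +
                 ('I_(b + Q) * 'I_k.+1 * bool)}| <= n)%N.
  by rewrite card_sum !card_prod !card_ord card_bool; lia.
exists (fun v => widen_ord le' (enum_rank v)) => u v /(congr1 val) /= /val_inj.
exact: enum_rank_inj.
Qed.

(** Suitable coins yield at least [Q * k.+1 / alpha] edges on more than half of the instances, which
    causes the factor 2, while [sum_card_out] bounds the total output. *)
Lemma approx_factor_tradeoff b Q k s : message_length_le Pi s ->
  (0 < Q)%N -> (Q <= P)%N -> (Q <= k.+1)%N ->
  (3 * ((b + Q) * k.+1) <= n)%N ->
  1 <= alpha /\
  b.+1%:R ^+ 2 * (Q%:R * k.+1%:R) <=
  2 * alpha * (b.+1%:R ^+ 2 * (3 * b%:R * k.+1%:R) + Q%:R * s.+2%:R).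
Proof.
move=> PiS Q0 QP Qk /exists_embedding[phi phi_inj].
pose F := @instance n Q b k phi.
have part w : edge_partition (whole phi (F w)) (@parts n P Q b k phi (F w)).
  by apply: instance_partition.
have mm w : (Q * k.+1 <= max_matching (whole phi (F w)))%N.
  by apply: max_matching_instance.
pose I := ({perm 'I_(b + Q)} * {perm 'I_(b + Q)} *
   {ffun 'I_Q * ('I_(b + Q) * 'I_(b + Q) * 'I_k.+1) -> bool})%type.
pose i0 : I := (1%g, 1%g, [ffun=> true]).
split.
  apply: (approx_factor_ge1 (part i0)).
  by apply: leq_trans (mm i0); rewrite muln_gt0 Q0.
have [w maj] := @exists_good_coins I (fun i => whole phi (F i))
  (fun i => @parts n P Q b k phi (F i)) i0 part.
have := @sum_card_out n P Q b k QP Qk phi phi_inj s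
  (fun p => message Pi p w) (referee Pi (left_side phi) w)
  (fun p H => PiS p w H).
move=> /(_ _)/wrap[G Gs GGs sG|]; first by rewrite -sG; exact: (PiM GGs w).
set N := (\sum_w _)%N => leN.
set S := (\sum_i _)%N in maj.
have SN : Q%:R * k.+1%:R * S%:R <= N%:R * alpha.
  rewrite /S /N !natr_sum mulr_sumr mulr_suml; apply: ler_sum => i _.
  case: (leP _ #|output _ _ _ _|%:R) => [le|_]; last first.
    by rewrite mulr0 mulr_ge0 // ltW.
  rewrite mulr1; move: le; rewrite ler_pdivrMr //; apply: le_trans.
  by rewrite -natrM ler_nat.
have I0 : 0 < #|{: I}|%:R :> R by rewrite ltr0n; apply/card_gt0P; exists i0.
rewrite -(ler_pM2l I0).
have maj' : #|{: I}|%:R <= 2 * S%:R :> R by rewrite -natrM ler_nat ltnW.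
have leN' : b.+1%:R ^+ 2 * N%:R <= #|{: I}|%:R *
    (b.+1%:R ^+ 2 * (3 * b%:R * k.+1%:R) + Q%:R * s.+2%:R) :> R.
  by rewrite -!natrX -!natrM -natrD -natrM ler_nat.
set Z := (_ + _) in leN' *.
apply: (@le_trans _ _ (2 * alpha * (b.+1%:R ^+ 2 * N%:R))); last first.
  by rewrite [leRHS]mulrCA ler_pM2l ?mulr_gt0.
apply: (@le_trans _ _ (2 * S%:R * (b.+1%:R ^+ 2 * (Q%:R * k.+1%:R)))).
  by rewrite ler_wpM2r // !mulr_ge0 ?exprn_ge0.
have -> : 2 * S%:R * (b.+1%:R ^+ 2 * (Q%:R * k.+1%:R)) =
   2 * b.+1%:R ^+ 2 * (Q%:R * k.+1%:R * S%:R) :> R by ring.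
have -> : 2 * alpha * (b.+1%:R ^+ 2 * N%:R) =
   2 * b.+1%:R ^+ 2 * (N%:R * alpha) by ring.
by rewrite ler_wpM2l // mulr_ge0 // exprn_ge0.
Qed.

End Protocol.

(** * Choice of the parameters and the final bound *)

Lemma exists_parameters (R : realType) (n P s : nat) (alpha : R) :
  (2 <= P)%N -> (P ^ 2 <= n)%N -> (0 < s)%N -> 1 <= alpha ->
  (27 * alpha) ^+ 4 * s%:R < P%:R * n%:R ->
  exists b Q k : nat,
  [/\ (0 < Q <= P)%N, (Q <= k.+1)%N, (3 * ((b + Q) * k.+1) <= n)%N &
   2 * alpha * (b.+1%:R ^+ 2 * (3 * b%:R * k.+1%:R) + Q%:R * s.+2%:R) <
   b.+1%:R ^+ 2 * (Q%:R * k.+1%:R) ].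
Proof.
move=> P2 Pn s0 a1 big.
have a4 : 1 <= alpha ^+ 4 by exact: exprn_ege1.
have s1 : 1 <= s%:R :> R by rewrite ler1n.
have Pn_big : (27 ^ 2 < P * n)%N.
  rewrite -(ltr_nat R) natrM natrX; apply: le_lt_trans big.
  rewrite exprMn -mulrA -[leLHS]mulr1; apply: ler_pM => //.
    by rewrite ler_weXn2l // ler1n.
  exact: mulr_ege1.
pose Q := ((P + 2) %/ 3)%N.
have Q0 : (0 < Q)%N by rewrite /Q; lia.
have QP : (Q <= P)%N by rewrite /Q; lia.
have PQ : (P <= 3 * Q)%N by rewrite /Q; lia.
have Q3 : (3 * Q <= P + 2)%N by rewrite /Q; lia.
(* For [9 <= P], [6 * Q ^ 2] is at most two thirds of [(P + 2) ^ 2], hence at most [P ^ 2]. For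
   smaller [P], [Q <= 3] and [Pn_big] forces [54 <= n]. *)
have Qn : (Q * (6 * Q) <= n)%N.
  have [P9|P9] := leqP 9 P; first by move: Pn; rewrite -mulnn; nia.
  have : (Q <= 3)%N by lia.
  nia.
clearbody Q.
have : (Q <= n %/ (6 * Q))%N by rewrite leq_divRL //; lia.
case E : (n %/ (6 * Q))%N => [|k] Qk; first by lia.
have kn : (k.+1 * (6 * Q) <= n)%N by rewrite -E; exact: leq_divM.
(* Rounding the positive quotient down loses at most a factor 2. *)
have nk : (n <= 12 * (Q * k.+1))%N.
  have : (n < k.+2 * (6 * Q))%N by rewrite -E ltn_ceil // muln_gt0.
  nia.
have a0 : 0 < alpha by lra.
pose x : R := Q%:R / (24 * alpha).
have x0 : 0 <= x by rewrite divr_ge0 // mulr_ge0 // ltW.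
have /andP[bx xb] := truncn_itv x0.
exists (Num.truncn x), Q, k; set b := Num.truncn x in bx xb *.
have ba : 24 * alpha * b%:R <= Q%:R.
  by move: bx; rewrite /x ler_pdivlMr ?mulr_gt0 // mulrC.
have ab : Q%:R <= 24 * alpha * b.+1%:R.
  by move: xb; rewrite /x ltr_pdivrMr ?mulr_gt0 // mulrC => /ltW.
have bQ : (b <= Q)%N.
  rewrite -(ler_nat R); apply: le_trans ba.
  by rewrite ler_peMl //; lra.
split=> //; first by rewrite Q0.
  by apply: leq_trans kn; nia.
clearbody b; clear x x0 bx xb E.
rewrite ltNge; apply/negP => H.
set B : R := b.+1%:R in H ab; set K : R := k.+1%:R in H.
have B1 : 1 <= B by rewrite ler1n.
have K1 : 1 <= K by rewrite ler1n.
have Q1 : 1 <= Q%:R :> R by rewrite ler1n.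
have s3 : s.+2%:R <= 3 * s%:R :> R by rewrite -natrM ler_nat; lia.
have PR : P%:R <= 3 * Q%:R :> R by rewrite -natrM ler_nat.
have nR : n%:R <= 12 * (Q%:R * K) :> R by rewrite -!natrM ler_nat.
(* The choice of [b] keeps the shared-vertex term below a quarter of [B ^+ 2 * K * Q%:R]; the other
   three quarters are at most [6 * alpha * s%:R * Q%:R]. *)
have step1 : B ^+ 2 * K <= 8 * alpha * s%:R.
  have h1 : 2 * alpha * (B ^+ 2 * (3 * b%:R * K)) <= B ^+ 2 * K * (Q%:R / 4).
    have -> : 2 * alpha * (B ^+ 2 * (3 * b%:R * K)) =
      B ^+ 2 * K * (24 * alpha * b%:R / 4) by field.
    by rewrite ler_wpM2l ?mulr_ge0 ?exprn_ge0 //; lra.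
  have h2 : 2 * alpha * (Q%:R * s.+2%:R) <= 6 * alpha * s%:R * Q%:R.
    have -> : 6 * alpha * s%:R * Q%:R = 2 * alpha * (Q%:R * (3 * s%:R)) by ring.
    by rewrite !ler_wpM2l //; lra.
  have : B ^+ 2 * K * Q%:R <= 8 * alpha * s%:R * Q%:R by lra.
  by rewrite ler_pM2r //; lra.
have step2 : Q%:R ^+ 2 * K <= 24 ^+ 2 * 8 * (alpha ^+ 3 * s%:R).
  have h1 : Q%:R ^+ 2 <= (24 * alpha * B) ^+ 2.
    by rewrite ler_sqr ?nnegrE //; lra.
  apply: (@le_trans _ _ ((24 * alpha * B) ^+ 2 * K)).
    by rewrite ler_wpM2r //; lra.
  have -> : (24 * alpha * B) ^+ 2 * K =
    24 ^+ 2 * alpha ^+ 2 * (B ^+ 2 * K) by ring.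
  have -> : 24 ^+ 2 * 8 * (alpha ^+ 3 * s%:R) =
    24 ^+ 2 * alpha ^+ 2 * (8 * alpha * s%:R) by ring.
  by rewrite ler_wpM2l // mulr_ge0 // exprn_ge0 // ltW.
have step3 : P%:R * n%:R <= 36 * (Q%:R ^+ 2 * K).
  have -> : 36 * (Q%:R ^+ 2 * K) = (3 * Q%:R) * (12 * (Q%:R * K)) by ring.
  by apply: ler_pM.
(* The estimate yields a third power; [1 <= alpha] allows passing to the fourth. *)
have step4 : alpha ^+ 3 * s%:R <= alpha ^+ 4 * s%:R.
  by rewrite ler_wpM2r // ler_weXn2l.
have A0 : 0 < alpha ^+ 4 * s%:R by apply: mulr_gt0; lra.
(* The contradiction rests on [36 * 24 ^ 2 * 8 < 27 ^ 4]. *)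
move: big; rewrite exprMn -mulrA.
set A3 := alpha ^+ 3 * _ in step2 step4; set A4 := alpha ^+ 4 * _ in A0 step4 *.
lra.
Qed.

Theorem theorem2 (R : realType) :
  exists c : R, 0 < c /\
  forall (n P s : nat) (eps : R) (d : measure_display)
    (Omega : measurableType d) (Pr : probability Omega R)
    (Pi : sim_protocol Omega n P) (alpha : R),
  (2 <= P)%N -> P%:R <= Num.sqrt (n%:R : R) -> (0 < s)%N ->
  eps < 1 / 2 ->
  outputs_matching Pi ->
  message_length_le Pi s ->
  0 < alpha ->
  approx_factor_with_error Pi Pr alpha eps ->
  c * ((P%:R * n%:R / s%:R) `^ (1 / 4)) <= alpha.
Proof.
exists (1 / 27); split; first by lra.
move=> n P s eps d Omega Pr Pi alpha P2 Pn s0 eps2 PiM PiS a0 PiA.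
have {}Pn : (P ^ 2 <= n)%N.
  rewrite -(ler_nat R) natrX -(sqr_sqrtr (ler0n R n)).
  by rewrite ler_sqr ?nnegrE ?sqrtr_ge0.
(* The smallest instance, with [b = 0], [Q = 1] and [k = 0], needs three vertices. *)
have a1 : 1 <= alpha.
  have [] // := @approx_factor_tradeoff _ _ _ Pr _ _ _ _ _ eps2 a0 PiM PiA
    0 1 0 _ PiS => //.
  - by lia.
  - by nia.
rewrite leNgt; apply/negP => lt.
have s0R : 0 < s%:R :> R by rewrite ltr0n.
have K0 : 0 <= P%:R * n%:R / s%:R :> R by rewrite divr_ge0 // mulr_ge0.
(* Fourth powers turn the negated claim into the hypothesis of [exists_parameters], whose parameters
   violate [approx_factor_tradeoff]. *)
have big : (27 * alpha) ^+ 4 * s%:R < P%:R * n%:R.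
  rewrite -ltr_pdivlMr //.
  have K4 : (P%:R * n%:R / s%:R) `^ (1 / 4) ^+ 4 = P%:R * n%:R / s%:R :> R.
    by rewrite -powR_mulrn ?powR_ge0 // -powRrM divfK // powRr1.
  rewrite -{}K4 ltrXn2r // ?nnegrE ?powR_ge0 //.
  - by lra.
  - by lra.
have [b [Q [k [/andP[Q0 QP] Qk bn]]]] := exists_parameters P2 Pn s0 a1 big.
have [_] := approx_factor_tradeoff eps2 a0 PiM PiA PiS Q0 QP Qk bn.
by rewrite leNgt => /negP.
Qed.
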